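(* Let $k\ge 1$, let ${\bf f^t}=(f^t_1,\dots,f^t_k)$ be a system of trigonometric series with real coefficients, let $n\in\mathbb{Z}_+$ and let $\overrightarrow{m}=(m_1,\dots,m_k)\in\mathbb{Z}_+^k$, $\overrightarrow{m}\neq(0,\dots,0)$, $m=m_1+\dots+m_k$, $n_j=n+m-m_j$. In order for Problem ${\bf A^t}$ to have a unique solution (up to a numerical factor) for the multi-index $(n,\overrightarrow{m})$ and the system ${\bf f^t}$, it is necessary and sufficient that the multi-index $(n,\overrightarrow m)$ be weakly normal for ${\bf f^t}$, i.e. $\operatorname{rank} H^t_{n,\overrightarrow m}=2m$. If $\operatorname{rank} H^t_{n,\overrightarrow m}=2m$, then for a certain choice of the normalizing factor the solution of Problem ${\bf A^t}$ and its remainders are given, for $j=1,\dots,k$, by $$Q^t_m(x)=D(n,\overrightarrow m;x),\qquad P^t_j(x)=\sum_{p=-n_j}^{n_j}d^j_p(n,\overrightarrow m)\,e^{ipx},$$ $$R^t_j(x)=\sum_{p=n+m+1}^{\infty}\bigl(d^j_p(n,\overrightarrow m)e^{ipx}+d^j_{-p}(n,\overrightarrow m)e^{-ipx}\bigr).$$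
   Context: $\mathbb{Z}_+$ denotes the non-negative integers. The system ${\bf f^t}=(f^t_1,\dots,f^t_k)$ consists of trigonometric series $f^t_j(x)=\frac{a^j_0}{2}+\sum_{l\ge1}(a^j_l\cos lx+b^j_l\sin lx)$ with real coefficients, assumed convergent for all $x\in\mathbb{R}$. In complex form $f^t_j(x)=\sum_{l\in\mathbb{Z}}c^j_le^{ilx}$ with $c^j_0=a^j_0/2$, $c^j_l=(a^j_l-ib^j_l)/2$, $c^j_{-l}=\overline{c^j_l}$ for $l\ge1$. A trigonometric polynomial of degree at most $N$ is $\sum_{p=-N}^{N}u_pe^{ipx}$ with $u_p\in\mathbb{C}$. Problem ${\bf A^t}$ for $(n,\overrightarrow m)$ and ${\bf f^t}$: find a trigonometric polynomial $Q^t_m\not\equiv0$ of degree at most $m$ and trigonometric polynomials $P^t_j$ of degree at most $n_j$ such that, for $j=1,\dots,k$, $$R^t_j(x):=Q^t_m(x)f^t_j(x)-P^t_j(x)=\sum_{l=n+m+1}^{\infty}(\tilde a^j_l\cos lx+\tilde b^j_l\sin lx)$$ for some complex $\tilde a^j_l,\tilde b^j_l$; that is, in the trigonometric series of $Q^t_mf^t_j-P^t_j$ (obtained by multiplying out and collecting the coefficients of $e^{ilx}$) all coefficients with $|l|\le n+m$ vanish. A solution is the tuple $(Q^t_m,P^t_1,\dots,P^t_k)$. The solution is called unique if for any two solutions there is a complex number $\lambda$ such that the first tuple equals $\lambda$ times the second. Matrices. For $l\in\mathbb{Z}$ let $\mathbb{C}^j_l=(c^j_{l+m}\ c^j_{l+m-1}\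 \dots\ c^j_{l-m+1}\ c^j_{l-m})$ (a row of length $2m+1$) and $E^t_m(x)=(e^{-imx}\ e^{-i(m-1)x}\ \dots\ 1\ \dots\ e^{i(m-1)x}\ e^{imx})$. If $m_j\ne0$, let $F^j_+$ be the $m_j\times(2m+1)$ matrix with rows, from top to bottom, $\mathbb{C}^j_{n_j+m_j},\mathbb{C}^j_{n_j+m_j-1},\dots,\mathbb{C}^j_{n_j+1}$, and $F^j_-$ the $m_j\times(2m+1)$ matrix with rows, from top to bottom, $\mathbb{C}^j_{-n_j-1},\mathbb{C}^j_{-n_j-2},\dots,\mathbb{C}^j_{-n_j-m_j}$. $D(n,\overrightarrow m;x)$ is the determinant of order $2m+1$ of the matrix obtained by stacking, from top to bottom, $F^k_+,\dots,F^2_+,F^1_+,E^t_m(x),F^1_-,F^2_-,\dots,F^k_-$ (blocks $F^j_\pm$ with $m_j=0$ are omitted). $H^t_{n,\overrightarrow m}$ is the $2m\times(2m+1)$ matrix obtained from this stacked matrix by removing its $(m+1)$-th row $E^t_m(x)$. $d^j_l(n,\overrightarrow m)$ is the determinant obtained from $D(n,\overrightarrow m;x)$ by replacing the row $E^t_m(x)$ by the row $\mathbb{C}^j_l$. The multi-index $(n,\overrightarrow m)$ is weakly normal for ${\bf f^t}$ if $\operatorname{rank}H^t_{n,\overrightarrow m}=2m$. *)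

(* Defs.v *)
From mathcomp Require Import all_boot all_order all_algebra.
From mathcomp Require Import complex.
From mathcomp Require Import all_classical all_reals all_analysis.

Set Implicit Arguments.
Unset Strict Implicit.
Unset Printing Implicit Defensive.

Import Order.TTheory GRing.Theory Num.Theory.
Import numFieldNormedType.Exports.

Local Open Scope classical_set_scope.
Local Open Scope complex_scope.
Local Open Scope ring_scope.

Section TrigonometricSeries.
Variable R : realType.

Definition trig_partial_sum (a b : nat -> R) (x : R) (N : nat) : R :=
  a 0%N / 2 +
  \sum_(1 <= l < N.+1) (a l * cos (l%:R * x) + b l * sin (l%:R * x)).

(* [Negz l] is the integer [- l.+1]; [b 0] is never used. *)
Definition ccoef (a b : nat -> R) (l : int) : R[i] :=
  match l with
  | Posz 0 => (a 0%N / 2)%:C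
  | Posz l => (a l / 2) -i* (b l / 2)
  | Negz l => (a l.+1 / 2) +i* (b l.+1 / 2)
  end.

Definition expi (t : R) : R[i] := cos t +i* sin t.

(* [P] is the function [x |-> \sum_(-N <= p <= N) u p * e^{ipx}], and the
   coefficient family [u] is extended by 0 outside [-N, N]. *)
Definition is_trig_poly (N : nat) (u : int -> R[i]) (P : R -> R[i]) : Prop :=
  (forall p : int, (N < `|p|)%N -> u p = 0) /\
  (forall x : R,
    P x = \sum_(i < (2 * N).+1) u (i%:Z - N%:Z) * expi ((i%:Z - N%:Z)%:~R * x)).

(* The coefficient of [e^{ilx}] after multiplying out
   [(\sum_(|p| <= N) u p * e^{ipx}) * (\sum_(q : int) c q * e^{iqx})]. *)
Definition mul_coef (N : nat) (u c : int -> R[i]) (l : int) : R[i] :=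
  \sum_(i < (2 * N).+1) u (i%:Z - N%:Z) * c (l - (i%:Z - N%:Z)).

Variable k : nat.
Implicit Types (c : 'I_k -> int -> R[i]) (n : nat) (m : 'I_k -> nat).

Definition mtotal m : nat := (\sum_j m j)%N.

(* The subtraction never truncates, as [m j <= mtotal m]. *)
Definition ndeg n m (j : 'I_k) : nat := (n + mtotal m - m j)%N.

(* [r] is the coefficient family of the trigonometric series of
   [Q * f_j - P], where [f_j] has coefficient family [c j]. *)
Definition is_remainder_series c n m (j : 'I_k) (Q P : R -> R[i])
    (r : int -> R[i]) : Prop :=
  exists u v : int -> R[i],
    [/\ is_trig_poly (mtotal m) u Q,
        is_trig_poly (ndeg n m j) v P
      & forall l : int, r l = mul_coef (mtotal m) u (c j) l - v l].

Definition is_solution c n m (Q : R -> R[i]) (P : 'I_k -> R -> R[i]) : Prop :=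
  [/\ exists u, is_trig_poly (mtotal m) u Q,
      exists x, Q x != 0
    & forall j : 'I_k, exists2 r : int -> R[i],
        is_remainder_series c n m j Q (P j) r
      & forall l : int, (`|l| <= n + mtotal m)%N -> r l = 0].

Definition has_unique_solution c n m : Prop :=
  (exists Q P, is_solution c n m Q P) /\
  (forall Q1 P1 Q2 P2, is_solution c n m Q1 P1 -> is_solution c n m Q2 P2 ->
    exists lambda : R[i],
      (forall x, Q1 x = lambda * Q2 x) /\
      (forall j x, P1 j x = lambda * P2 j x)).

Definition Crow c m (j : 'I_k) (l : int) : 'rV[R[i]]_((2 * mtotal m).+1) :=
  \row_i c j (l + (mtotal m)%:Z - i%:Z).

Definition Erow m (x : R) : 'rV[R[i]]_((2 * mtotal m).+1) :=
  \row_i expi ((i%:Z - (mtotal m)%:Z)%:~R * x).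

Definition Fplus c n m (j : 'I_k) : seq 'rV[R[i]]_((2 * mtotal m).+1) :=
  [seq Crow c m j (ndeg n m j + i)%:Z | i <- rev (iota 1 (m j))].

Definition Fminus c n m (j : 'I_k) : seq 'rV[R[i]]_((2 * mtotal m).+1) :=
  [seq Crow c m j (- (ndeg n m j + i)%:Z) | i <- iota 1 (m j)].

Definition upper_rows c n m : seq 'rV[R[i]]_((2 * mtotal m).+1) :=
  flatten [seq Fplus c n m j | j <- rev (enum 'I_k)].

Definition lower_rows c n m : seq 'rV[R[i]]_((2 * mtotal m).+1) :=
  flatten [seq Fminus c n m j | j <- enum 'I_k].

Definition rows_mx p q (s : seq 'rV[R[i]]_q) : 'M[R[i]]_(p, q) :=
  \matrix_(i < p) nth 0 s i.

Definition stacked_mx c n m (r : 'rV[R[i]]_((2 * mtotal m).+1)) :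
    'M[R[i]]_((2 * mtotal m).+1) :=
  rows_mx _ (upper_rows c n m ++ r :: lower_rows c n m).

Definition Hmx c n m : 'M[R[i]]_(2 * mtotal m, (2 * mtotal m).+1) :=
  rows_mx _ (upper_rows c n m ++ lower_rows c n m).

Definition Ddet c n m (x : R) : R[i] := \det (stacked_mx c n (Erow m x)).

Definition ddet c n m (j : 'I_k) (l : int) : R[i] :=
  \det (stacked_mx c n (Crow c m j l)).

Definition weakly_normal c n m : Prop := \rank (Hmx c n m) = (2 * mtotal m)%N.

Definition Psol c n m (j : 'I_k) (x : R) : R[i] :=
  \sum_(i < (2 * ndeg n m j).+1)
    ddet c n m j (i%:Z - (ndeg n m j)%:Z) *
    expi ((i%:Z - (ndeg n m j)%:Z)%:~R * x).

Definition remainder_partial_sum c n m (j : 'I_k) (x : R) (N : nat) : R[i] :=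
  \sum_((n + mtotal m).+1 <= p < N.+1)
    (ddet c n m j p%:Z * expi (p%:R * x) +
     ddet c n m j (- p%:Z) * expi (- (p%:R * x))).

Lemma size_upper_rows c n m : size (upper_rows c n m) = mtotal m.
Proof.
rewrite /upper_rows size_flatten /shape -map_comp map_rev sumn_rev sumnE.
rewrite big_map big_enum /=.
by apply: eq_bigr => j _; rewrite size_map size_rev size_iota.
Qed.

Lemma size_lower_rows c n m : size (lower_rows c n m) = mtotal m.
Proof.
rewrite /lower_rows size_flatten /shape -map_comp sumnE big_map big_enum /=.
by apply: eq_bigr => j _; rewrite size_map size_iota.
Qed.

(* The default value of [nth] in [rows_mx] is never reached. *)
Lemma size_stacked_rows c n m (r : 'rV[R[i]]_((2 * mtotal m).+1)) :
  size (upper_rows c n m ++ r :: lower_rows c n m) = (2 * mtotal m).+1.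
Proof. by rewrite size_cat /= size_upper_rows size_lower_rows addnS mul2n addnn. Qed.

Lemma row_stacked_mx c n m (r : 'rV[R[i]]_((2 * mtotal m).+1)) :
  row (inord (mtotal m)) (stacked_mx c n r) = r.
Proof.
rewrite rowK inordK; last by rewrite ltnS leq_pmull.
by rewrite nth_cat size_upper_rows ltnn subnn.
Qed.

Lemma Hmx_row' c n m (r : 'rV[R[i]]_((2 * mtotal m).+1)) :
  Hmx c n m = row' (inord (mtotal m)) (stacked_mx c n r).
Proof.
apply/row_matrixP => i; rewrite rowK; apply/rowP => q.
rewrite !mxE /= inordK; last by rewrite ltnS leq_pmull.
rewrite /bump !nth_cat size_upper_rows; case: (leqP (mtotal m) i) => him /=.
  by rewrite add1n ltnNge (leqW him) /= subSn.
by rewrite add0n him.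
Qed.

End TrigonometricSeries.

(* Main.v *)
(* Writing Q = \sum_(|p| <= m) u_p e^{ipx}, the coefficients of Q f_j - P_j of
   index n_j < |l| <= n + m vanish exactly when u is in the kernel of H, and P_j
   is then determined by u.  Solutions thus correspond to the nonzero vectors of
   that kernel, so uniqueness up to a factor means that it is a line, i.e. that
   H has rank 2m.  In that case the line is spanned by the cofactors of the
   middle row of the stacked matrix, and Laplace expansion along that row gives
   the determinantal formulas.

   For the convergence of the remainder, the symmetric partial sums of the
   product series are combinations of shifted symmetric partial sums of the
   series of f_j.  A shift changes such a sum by boundedly many terms, which
   tend to 0 because convergence everywhere forces the coefficients to tend to 0
   (Cantor-Lebesgue).  For the sine coefficients the latter is proved by
   constructing, with nested intervals, a point x at which |sin(s_i x)| stays
   away from 0 along a lacunary sequence s_i. *)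
Require Import Defs.
From mathcomp Require Import all_boot all_order all_algebra.
From mathcomp Require Import complex.
From mathcomp Require Import zify ring lra.
From mathcomp Require Import all_classical all_reals all_analysis.

Import Order.TTheory GRing.Theory Num.Theory.
Import numFieldNormedType.Exports.

Local Open Scope classical_set_scope.
Local Open Scope complex_scope.
Local Open Scope ring_scope.

(** * Complex exponentials and trigonometric polynomials *)

Lemma expiD {R : realType} (s t : R) : expi (s + t) = expi s * expi t.
Proof. by rewrite /expi cosD sinD; simpc; rewrite [cos s * sin t + _]addrC. Qed.

Lemma expi0 {R : realType} : expi (0 : R) = 1.
Proof. by rewrite /expi cos0 sin0. Qed.

Lemma expi_natM {R : realType} (i : nat) (x : R) :
  expi (i%:R * x) = expi x ^+ i.
Proof.
elim: i => [|i IH]; first by rewrite mul0r expi0 expr0.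
by rewrite -natr1 mulrDl mul1r expiD IH exprSr.
Qed.

Lemma norm_expi {R : realType} (t : R) : `|expi t| = 1.
Proof. by rewrite normc_def /= cos2Dsin2 sqrtr1. Qed.

(** Cosine is injective on [[0, pi]], which contains [[0, 1]]. This supplies as many distinct points
    of the unit circle as needed. *)
Lemma expi_inj01 {R : realType} (s t : R) :
  0 <= s <= 1 -> 0 <= t <= 1 -> expi s = expi t -> s = t.
Proof.
have pi1 : 1 <= pi :> R by apply: le_trans (pi_ge2 R); rewrite ler1n.
move=> /andP[s0 s1] /andP[t0 t1] /(congr1 (@complex.Re R)) /=.
by apply: cos_inj; rewrite in_itv /= ?s0 ?t0 (le_trans _ pi1).
Qed.

Definition trig_poly {R : realType} (N : nat) (u : int -> R[i]) (x : R) : R[i] :=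
  \sum_(i < (2 * N).+1) u (i%:Z - N%:Z) * expi ((i%:Z - N%:Z)%:~R * x).

Lemma trig_poly_shift {R : realType} (N : nat) (u : int -> R[i]) (x : R) :
  trig_poly N u x * expi (N%:R * x) =
  (\poly_(i < (2 * N).+1) u (i%:Z - N%:Z)).[expi x].
Proof.
rewrite horner_poly mulr_suml; apply: eq_bigr => i _.
rewrite -mulrA -expiD -expi_natM; congr (_ * expi _).
by rewrite -mulrDl rmorphB /= subrK.
Qed.

(** After multiplication by [e^{iNx}] the function is a polynomial in [e^{ix}] that vanishes on the
    whole unit circle, hence has too many roots. *)
Lemma trig_poly_eq0 {R : realType} (N : nat) (u : int -> R[i]) :
  (forall x, trig_poly N u x = 0) ->
  forall i, (i < (2 * N).+1)%N -> u (i%:Z - N%:Z) = 0.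
Proof.
move=> u0 i iN; pose p : {poly R[i]} := \poly_(i < (2 * N).+1) u (i%:Z - N%:Z).
suff p0 : p = 0 by have := coef_poly (2 * N).+1 (fun i => u (i%:Z - N%:Z)) i;
  rewrite iN -/p p0 coef0 => <-.
apply/eqP/negPn/negP => pN0; pose K := size p.
(* [K] distinct nodes in [[0, 1]] suffice, since a nonzero polynomial of size [K] has fewer than [K]
   roots. *)
pose node (q : nat) : R := q%:R / K.+1%:R.
pose rs := [seq expi (node q) | q <- iota 0 K].
have node01 q : q \in iota 0 K -> 0 <= node q <= 1.
  rewrite mem_iota add0n /= => qK; rewrite divr_ge0 ?ler0n//=.
  by rewrite ler_pdivrMr ?ltr0n// mul1r ler_nat ltnW// ltnW.
suff: (size rs < size p)%N by rewrite size_map size_iota ltnn.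
apply: max_poly_roots => //.
  by apply/allP => _ /mapP[q _ ->]; rewrite /root -trig_poly_shift u0 mul0r.
rewrite map_inj_in_uniq ?iota_uniq// => q1 q2 /node01 h1 /node01 h2.
move=> /(expi_inj01 _ _ h1 h2) /divIf; rewrite pnatr_eq0 => /(_ isT)/eqP.
by rewrite eqr_nat => /eqP.
Qed.

Lemma mul_trig_poly {R : realType} (N : nat) (u : int -> R[i]) (a : R[i]) x :
  a * trig_poly N u x = trig_poly N (fun p => a * u p) x.
Proof. by rewrite mulr_sumr; apply: eq_bigr => i _; rewrite mulrA. Qed.

Lemma sub_trig_poly {R : realType} (N : nat) (u v : int -> R[i]) x :
  trig_poly N u x - trig_poly N v x = trig_poly N (fun p => u p - v p) x.
Proof. by rewrite -sumrB; apply: eq_bigr => i _; rewrite mulrBl. Qed.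

Lemma trig_poly_inj {R : realType} (N : nat) (u v : int -> R[i]) :
  trig_poly N u =1 trig_poly N v ->
  forall i, (i < (2 * N).+1)%N -> u (i%:Z - N%:Z) = v (i%:Z - N%:Z).
Proof.
move=> uv i iN; apply/eqP; rewrite -subr_eq0; apply/eqP.
apply: (trig_poly_eq0 N (fun p => u p - v p)) iN => x.
by rewrite -sub_trig_poly uv subrr.
Qed.

Lemma eq_trig_poly {R : realType} (N : nat) (u v : int -> R[i]) x :
  (forall p : int, (`|p| <= N)%N -> u p = v p) ->
  trig_poly N u x = trig_poly N v x.
Proof.
move=> uv; apply: eq_bigr => i _; rewrite uv//.
by have := ltn_ord i; lia.
Qed.

Lemma is_trig_poly_trunc {R : realType} (N : nat) (u : int -> R[i]) :
  is_trig_poly N (fun p => if (`|p| <= N)%N then u p else 0) (trig_poly N u).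
Proof.
split=> [p|x]; first by rewrite ltnNge => /negbTE ->.
by apply: eq_bigr => i _; rewrite ifT//; have := ltn_ord i; lia.
Qed.

(* Entry [i] of [w] is the coefficient of index [i - M]. *)
Definition row_coef {R : realType} (M : nat) (w : 'rV[R[i]]_(2 * M).+1)
    (p : int) : R[i] :=
  if (`|p| <= M)%N then w 0 (inord `|p + M%:Z|) else 0.

Lemma row_coefE {R : realType} (M : nat) (w : 'rV[R[i]]_(2 * M).+1)
    (i : 'I_(2 * M).+1) :
  row_coef M w (i%:Z - M%:Z) = w 0 i.
Proof.
have := ltn_ord i => iM; rewrite /row_coef ifT; last lia.
by congr (w 0 _); apply/val_inj; rewrite /= inordK; lia.
Qed.

Lemma row_coef_out {R : realType} (M : nat) (w : 'rV[R[i]]_(2 * M).+1) (p : int) :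
  (M < `|p|)%N -> row_coef M w p = 0.
Proof. by rewrite /row_coef ltnNge => /negbTE ->. Qed.

Lemma row_coefK {R : realType} (M : nat) (u : int -> R[i]) (p : int) :
  (forall p : int, (M < `|p|)%N -> u p = 0) ->
  row_coef M (\row_i u (i%:Z - M%:Z)) p = u p.
Proof.
move=> u0; rewrite /row_coef; case: leqP => [pM|/u0//].
by rewrite mxE inordK; [congr u|]; lia.
Qed.

(** * Solutions as nonzero kernel vectors *)

Section Kernel.
Context {R : realType} {k : nat}.
Variables (c : 'I_k -> int -> R[i]) (n : nat) (m : 'I_k -> nat).
Local Notation M := (mtotal m).
Local Notation H := (Hmx c n m).
Implicit Types (w : 'rV[R[i]]_(2 * M).+1) (j : 'I_k) (l : int).

Lemma leq_mtotal j : (m j <= M)%N.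
Proof. by rewrite /mtotal (bigD1 j)//= leq_addr. Qed.

Lemma ndegDm j : (ndeg n m j + m j = n + M)%N.
Proof. by rewrite subnK// (leq_trans (leq_mtotal j))// leq_addl. Qed.

Definition Qker w : R -> R[i] := trig_poly M (row_coef M w).

(** The coefficient of index [l] of the product series Q f_j, when [w] lists the coefficients of
    Q. *)
Definition mul_row w j l : R[i] := \sum_i Crow c m j l 0 i * w 0 i.

Definition Pker w j : R -> R[i] := trig_poly (ndeg n m j) (mul_row w j).

Lemma mul_rowE w j l : mul_row w j l = mul_coef M (row_coef M w) (c j) l.
Proof.
apply: eq_bigr => i _; rewrite row_coefE mxE mulrC; congr (_ * c j _); lia.
Qed.

Lemma Qker_inj w1 w2 : Qker w1 =1 Qker w2 -> w1 = w2.
Proof.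
by move=> /trig_poly_inj w12; apply/rowP => i; rewrite -!row_coefE w12.
Qed.

Lemma Qker0 x : Qker 0 x = 0.
Proof. by rewrite /Qker /trig_poly big1// => i _; rewrite row_coefE mxE mul0r. Qed.

(** The kernel depends only on the set of rows, so their order is dropped; the sign of [l] tells the
    upper block from the lower one. *)
Lemma mem_rows (r : 'rV[R[i]]_(2 * M).+1) :
  r \in upper_rows c n m ++ lower_rows c n m <->
  exists j l, (ndeg n m j < `|l| <= n + M)%N /\ r = Crow c m j l.
Proof.
rewrite mem_cat; split.
  move=> /orP[|] /flattenP[_ /mapP[j _ ->]] /mapP[i hi ->]; exists j.
    exists (ndeg n m j + i)%:Z; split=> //; move: hi.
    by rewrite mem_rev mem_iota -(ndegDm j); lia.
  exists (- (ndeg n m j + i)%:Z); split=> //; move: hi.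
  by rewrite mem_iota -(ndegDm j); lia.
move=> [j [l [hl ->]]]; rewrite -(ndegDm j) in hl.
have [l0|l0] := lerP 0 l; apply/orP; [left|right]; apply/flattenP.
  exists (Fplus c n m j); first by rewrite map_f// mem_rev mem_enum.
  apply/mapP; exists (`|l| - ndeg n m j)%N; first by rewrite mem_rev mem_iota; lia.
  by congr Crow; lia.
exists (Fminus c n m j); first by rewrite map_f// mem_enum.
apply/mapP; exists (`|l| - ndeg n m j)%N; first by rewrite mem_iota; lia.
by congr Crow; lia.
Qed.

Lemma size_rows : size (upper_rows c n m ++ lower_rows c n m) = (2 * M)%N.
Proof. by rewrite size_cat size_upper_rows size_lower_rows mul2n addnn. Qed.

Lemma kerHP w :
  (w <= kermx H^T)%MS <->
  forall j l, (ndeg n m j < `|l| <= n + M)%N -> mul_row w j l = 0.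
Proof.
split=> [/sub_kermxP wH j l hl | wH].
  have /mem_rows : exists j' l', (ndeg n m j' < `|l'| <= n + M)%N /\
    Crow c m j l = Crow c m j' l' by exists j, l.
  move=> /(nthP 0)[i0]; rewrite size_rows => iM E.
  have := congr1 (fun A : 'rV_(2 * M) => A 0 (Ordinal iM)) wH; rewrite !mxE => <-.
  by apply: eq_bigr => q _; rewrite mulrC -E !mxE.
apply/sub_kermxP/rowP => i; rewrite !mxE.
have /mem_rows[j [l [hl E]]] : nth 0 (upper_rows c n m ++ lower_rows c n m) i
  \in upper_rows c n m ++ lower_rows c n m by rewrite mem_nth// size_rows.
transitivity (mul_row w j l); last exact: wH.
by apply: eq_bigr => q _; rewrite mulrC -E !mxE.
Qed.

Lemma is_remainder_ker w j :
  (w <= kermx H^T)%MS ->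
  is_remainder_series c n m j (Qker w) (Pker w j)
    (fun l => if (n + M < `|l|)%N then mul_row w j l else 0).
Proof.
move=> /kerHP wH.
exists (row_coef M w), (fun l => if (`|l| <= ndeg n m j)%N then mul_row w j l else 0).
split; first by split=> // p; exact: row_coef_out.
  exact: is_trig_poly_trunc.
move=> l; rewrite -mul_rowE; have := ndegDm j => e.
case: ltnP => nl; case: leqP => dl; rewrite ?subr0 ?subrr//; first lia.
by rewrite wH// dl.
Qed.

Lemma is_solutionP Q P :
  is_solution c n m Q P <->
  exists w, [/\ w != 0, (w <= kermx H^T)%MS, Q =1 Qker w
              & forall j, P j =1 Pker w j].
Proof.
split; last first.
  move=> [w [wN0 wH QE PE]]; have {}QE : Q = Qker w by apply/funext.
  have {}PE : P = Pker w by apply/funext => j; apply/funext => x; exact: PE.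
  rewrite QE PE; split.
  - by exists (row_coef M w); split=> // p; exact: row_coef_out.
  - apply/not_existsP => Q0; move/eqP: wN0; apply; apply: Qker_inj => x.
    by rewrite Qker0; apply/eqP/negPn/negP; exact: Q0.
  - move=> j; exists (fun l => if (n + M < `|l|)%N then mul_row w j l else 0).
      exact: is_remainder_ker.
    by move=> l; rewrite leqNgt => /negbTE ->.
move=> [[u [u0 uQ]] [x0 Qx0] sol].
pose w : 'rV[R[i]]_(2 * M).+1 := \row_i u (i%:Z - M%:Z).
have QE : Q =1 Qker w.
  by move=> x; rewrite uQ; apply: eq_trig_poly => p _; rewrite row_coefK.
(* For each [j] the remainder comes with its own coefficient family of [Q]; injectivity of
   coefficients identifies all of them with [w]. *)
have coefE u' : is_trig_poly M u' Q ->
    forall l j, mul_coef M u' (c j) l = mul_row w j l.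
  move=> [u'0 u'Q] l j; rewrite mul_rowE; apply: eq_bigr => i _; congr (_ * _).
  rewrite row_coefK//; apply: (trig_poly_inj M) => // x.
  by rewrite /trig_poly -u'Q -uQ.
exists w; split=> //.
- by apply: contraNneq Qx0 => w0; rewrite QE w0 Qker0.
- apply/kerHP => j l /andP[l1 l2].
  have [r [u' [v [hu' [v0 _] rE]]] r0] := sol j.
  by have := r0 l l2; rewrite rE (coefE _ hu') v0// subr0.
(* For [|p| <= n_j] the remainder coefficient vanishes because [n_j <= n + m], which forces [v p] to
   be the product coefficient. *)
- move=> j x; have [r [u' [v [hu' [_ vP] rE]]] r0] := sol j.
  rewrite vP; apply: eq_trig_poly => p pn; have := r0 p.
  rewrite rE (coefE _ hu') => /(_ _)/eqP; rewrite subr_eq0 => h; apply/esym/eqP/h.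
  by have := ndegDm j; lia.
Qed.

Lemma QkerZ (a : R[i]) w x : Qker (a *: w) x = a * Qker w x.
Proof.
rewrite mul_trig_poly; apply: eq_bigr => i _.
by rewrite !row_coefE mxE.
Qed.

Lemma PkerZ (a : R[i]) w j x : Pker (a *: w) j x = a * Pker w j x.
Proof.
rewrite mul_trig_poly; apply: eq_bigr => i _; congr (_ * _).
by rewrite mulr_sumr; apply: eq_bigr => q _; rewrite [(a *: w) _ _]mxE mulrCA.
Qed.

Lemma rank_kerH : \rank (kermx H^T) = ((2 * M).+1 - \rank H)%N.
Proof. by rewrite mxrank_ker mxrank_tr. Qed.

Lemma is_solution_ker w : w != 0 -> (w <= kermx H^T)%MS ->
  is_solution c n m (Qker w) (Pker w).
Proof. by move=> w0 wH; apply/is_solutionP; exists w; split. Qed.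

Lemma kerH_proportional : weakly_normal c n m ->
  forall w1 w2, w2 != 0 -> (w1 <= kermx H^T)%MS -> (w2 <= kermx H^T)%MS ->
  exists a, w1 = a *: w2.
Proof.
move=> rH w1 w2 w2N0 w1K w2K; apply/sub_rVP/(submx_trans w1K).
by rewrite -(mxrank_leqif_sup w2K) rank_kerH rH rank_rV w2N0 subSnn.
Qed.

(** [H] has one more column than rows, so its kernel is nonzero and a solution always exists. *)
Lemma exists_kerH :
  exists2 w : 'rV[R[i]]_(2 * M).+1, w != 0 & (w <= kermx H^T)%MS.
Proof.
exists (nz_row (kermx H^T)); last exact: nz_row_sub.
rewrite nz_row_eq0 -mxrank_eq0 rank_kerH subn_eq0 -ltnNge ltnS.
exact: rank_leq_row.
Qed.

Lemma has_unique_solutionP : has_unique_solution c n m <-> weakly_normal c n m.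
Proof.
have [w0 w0N0 w0K] := exists_kerH; split=> [[_ uniq]|rH]; last first.
  split=> [|Q1 P1 Q2 P2]; first by exists (Qker w0), (Pker w0); exact: is_solution_ker.
  move=> /is_solutionP[w1 [w1N0 w1K Q1E P1E]] /is_solutionP[w2 [w2N0 w2K Q2E P2E]].
  have [a w12] := kerH_proportional rH _ _ w2N0 w1K w2K; exists a.
  by split=> *; rewrite ?Q1E ?Q2E ?P1E ?P2E w12 ?QkerZ ?PkerZ.
apply/eqP; rewrite eqn_leq rank_leq_row /=.
(* If one vector spans the kernel, then [2m + 1 - rank H <= 1], which is the missing inequality. *)
suff /mxrankS : (kermx H^T <= w0)%MS by rewrite rank_kerH rank_rV w0N0; lia.
apply/row_subP => i; have [->|wN0] := eqVneq (row i (kermx H^T)) 0.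
  exact: sub0mx.
have wK := row_sub i (kermx H^T).
have [a [QE _]] := uniq _ _ _ _ (is_solution_ker _ wN0 wK) (is_solution_ker _ w0N0 w0K).
apply/sub_rVP; exists a; apply: Qker_inj => x; rewrite QE QkerZ//.
Qed.

(** * Determinantal formulas from the cofactors of the middle row *)

Definition mid_cofactors : 'rV[R[i]]_(2 * M).+1 :=
  \row_i cofactor (stacked_mx c n (0 : 'rV_(2 * M).+1)) (inord M) i.

(** Laplace expansion along the middle row: deleting that row leaves [H] whatever [r] is, so the
    cofactors may be computed with a zero row there. *)
Lemma det_stacked (r : 'rV[R[i]]_(2 * M).+1) :
  \det (stacked_mx c n r) = \sum_i r 0 i * mid_cofactors 0 i.
Proof.
rewrite (expand_det_row _ (inord M)); apply: eq_bigr => i _.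
rewrite [mid_cofactors _ _]mxE; congr (_ * _).
  by rewrite -[in RHS](row_stacked_mx c n r) [in RHS]mxE.
rewrite /cofactor; congr (_ * \det _); apply/matrixP => p q.
have := etrans (esym (Hmx_row' c n r)) (Hmx_row' c n 0).
by move=> /matrixP/(_ p (lift i q)); rewrite !mxE.
Qed.

Lemma ddetE j l : ddet c n m j l = mul_row mid_cofactors j l.
Proof. exact: det_stacked. Qed.

Lemma DdetE x : Ddet c n m x = Qker mid_cofactors x.
Proof.
by rewrite /Ddet det_stacked; apply: eq_bigr => i _; rewrite row_coefE mxE mulrC.
Qed.

Lemma PsolE j x : Psol c n m j x = Pker mid_cofactors j x.
Proof. by apply: eq_bigr => i _; rewrite ddetE. Qed.

(** Pairing the cofactors with a row of [H] gives the determinant with that row repeated in the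
    middle, which is zero. *)
Lemma mid_cofactors_ker : (mid_cofactors <= kermx H^T)%MS.
Proof.
apply/sub_kermxP/rowP => i; rewrite [in RHS]mxE.
pose r := row i H.
transitivity (\det (stacked_mx c n r)).
  by rewrite det_stacked mxE; apply: eq_bigr => q _; rewrite mulrC !mxE.
apply: (@determinant_alternate _ _ _ (inord M) (lift (inord M) i)) => [|q].
  by rewrite neq_lift.
have -> : stacked_mx c n r (inord M) q = r 0 q.
  by rewrite -[in RHS](row_stacked_mx c n r) [in RHS]mxE.
have /matrixP/(_ i q) := Hmx_row' c n r; rewrite [RHS]mxE => <-.
by rewrite [LHS]mxE.
Qed.

(** Rank [2m] leaves some unit vector outside the row space of [H]. Put in the middle, it makes the
    stacked matrix invertible, so the cofactors cannot all vanish. *)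
Lemma mid_cofactors_neq0 : weakly_normal c n m -> mid_cofactors != 0.
Proof.
move=> rH; have [i rNH] : exists i, ~~ (row i 1%:M <= H)%MS.
  apply/row_subPn; apply/negP => /mxrankS; rewrite mxrank1 rH; lia.
set r : 'rV[R[i]]_(2 * M).+1 := row i 1%:M in rNH.
apply/eqP => cof0; pose S := stacked_mx c n r.
have rS : (r <= S)%MS by rewrite -[X in (X <= _)%MS](row_stacked_mx c n r) row_sub.
have HS : (H <= S)%MS.
  apply/row_subP => q; rewrite (Hmx_row' c n r).
  suff -> : row q (row' (inord M) S) = row (lift (inord M) q) S by exact: row_sub.
  by apply/rowP => p; rewrite !mxE.
have SU : S \in unitmx.
  rewrite -row_full_unit -col_leq_rank.
  have HrS : (H + r <= S)%MS by rewrite addsmx_sub HS rS.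
  apply: leq_trans (mxrankS HrS).
  rewrite -[X in (X.+1 <= _)%N]rH ltn_neqAle mxrankS ?addsmxSl// andbT.
  by rewrite (mxrank_leqif_sup (addsmxSl H r)) addsmx_sub (negbTE rNH) andbF.
move: SU; rewrite unitmxE det_stacked big1 ?unitr0// => q _.
by rewrite cof0 [X in _ * X]mxE mulr0.
Qed.
End Kernel.

(** * Coefficients of an everywhere convergent trigonometric series tend to 0 *)

Lemma cvgn_diff0 (K : numFieldType) (V : normedModType K) (u : nat -> V) (l : V) :
  u @ \oo --> l -> (fun N => u N.+1 - u N) @ \oo --> (0 : V).
Proof.
by move=> ul; rewrite -(subrr l); apply: cvgB => //; rewrite cvg_shiftS.
Qed.

Lemma cos_periodic_nat {R : realType} (q : nat) (t : R) :
  cos (t + q%:R * (pi *+ 2)) = cos t.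
Proof. by rewrite mulr_natl (periodicn (@cosD2pi R)). Qed.

(** As [2 sin^2 t = 1 - cos 2t], it suffices that [cos 2t <= 0]. Here [y] is the offset of [2t] from
    [pi + 2 q pi], so [cos 2t = - cos y] with [|y| <= pi / 2]. *)
Lemma sin_sqr_ge {R : realType} (q : nat) (t : R) :
  pi / 4 <= t - q%:R * pi <= 3 * pi / 4 -> 1 / 2 <= sin t ^+ 2.
Proof.
move=> /andP[t1 t2]; have := @cos_mulr2n R t.
pose y : R := t *+ 2 - pi - 2 * (q%:R * pi).
have -> : t *+ 2 = y + pi + q%:R * (pi *+ 2) by rewrite /y; ring.
rewrite cos_periodic_nat cosDpi.
have : 0 <= cos y by apply: cos_ge0_pihalf; rewrite /y; apply/andP; split; lra.
by have := cos2Dsin2 t; lra.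
Qed.

Lemma lacunary_sin_large {R : realType} (s : nat -> nat) :
  (0 < s 0)%N -> (forall i, (4 * s i <= s i.+1)%N) ->
  exists x : R, forall i, 1 / 2 <= sin ((s i)%:R * x) ^+ 2.
Proof.
move=> s0 s4; have pi0 := pi_gt0 R.
have sgt0 i : (0 < s i)%N by elim: i => // i; have := s4 i; lia.
(* For [x >= 0] this is the first integer whose multiple of [pi / l] exceeds [x], so the next
   interval starts to the right of [x]. *)
pose q (x : R) l := (Num.truncn (x * l%:R / pi)).+1.
pose A := fix A i : R := match i with
  | 0%N => (1 / 4) * pi / (s 0%N)%:R
  | i.+1 => ((q (A i) (s i.+1))%:R + 1 / 4) * pi / (s i.+1)%:R
  end.
(* The intervals [A i, B i] are nested, and on the i-th one [s i * x] lies,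
   modulo pi, in [pi / 4, 3 * pi / 4]. *)
pose B i := A i + pi / (2 * (s i)%:R).
have sR i : 0 < (s i)%:R :> R by rewrite ltr0n.
have A0 i : 0 <= A i.
  by case: i => [|i] /=; apply: divr_ge0; rewrite ?ler0n//; apply: mulr_ge0;
    rewrite ?(ltW pi0)// ?addr_ge0 ?ler0n//; lra.
have AS i : A i <= A i.+1 /\ B i.+1 <= B i.
  have /truncn_itv/andP[] : 0 <= A i * (s i.+1)%:R / pi.
    by rewrite divr_ge0 ?mulr_ge0 ?ler0n ?(ltW pi0).
  rewrite ler_pdivlMr// ltr_pdivrMr// => t1 t2.
  have s4R : 4 * (s i)%:R <= (s i.+1)%:R :> R by rewrite -natrM ler_nat.
  rewrite /B [A i.+1]/= /q; move: t1 t2; set t := Num.truncn _; rewrite -natr1.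
  move: (sR i) (sR i.+1) s4R; move: (A i) => x; set u := (s i)%:R; set v := (s i.+1)%:R.
  move: (t%:R : R) => y u0 v0 uv t1 t2; split.
    by rewrite ler_pdivlMr//; nra.
  have vuV : v^-1 <= u^-1 / 4.
    by rewrite -invfM lef_pV2 ?posrE// 1?mulrC//; lra.
  (* The new right end is at most [7/4 * pi/v] beyond [x]. Since [v >= 4u], this is at most
     [7/16 * pi/u], below the old length [pi/(2u)]. *)
  have h : (y + 1 + 1 / 4) * pi / v + pi / (2 * v) <= x + (7 / 4) * (pi / v).
    suff : y * pi / v <= x.
      have -> : (y + 1 + 1 / 4) * pi / v + pi / (2 * v) =
        y * pi / v + 7 / 4 * (pi / v) by field; rewrite gt_eqF.
      by lra.
    by rewrite ler_pdivrMr.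
  apply: (le_trans h); rewrite lerD2l.
  have -> : pi / (2 * u) = 2 * pi * (u^-1 / 4) by field; rewrite gt_eqF.
  have : 0 < v^-1 by rewrite invr_gt0.
  by nra.
have Amono i j : (i <= j)%N -> A i <= A j.
  move=> /subnK <-; elim: (j - i)%N => // d IH.
  by rewrite addSn; exact: le_trans IH (AS _).1.
have Bmono i j : (i <= j)%N -> B j <= B i.
  move=> /subnK <-; elim: (j - i)%N => // d IH.
  by rewrite addSn; exact: le_trans (AS _).2 IH.
have AB i : A i <= B i.
  by rewrite lerDl divr_ge0 ?mulr_ge0 ?ler0n ?(ltW pi0).
have ABij i j : A i <= B j.
  have [ij|/ltnW ji] := leqP i j; first exact: le_trans (Amono _ _ ij) (AB j).
  exact: le_trans (AB i) (Bmono _ _ ji).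
have rA0 : range A !=set0 by exists (A 0%N), 0%N.
have ubB j : ubound (range A) (B j) by move=> _ [i _ <-]; exact: ABij.
exists (sup (range A)) => i.
have xA : A i <= sup (range A).
  by apply: sup_upper_bound; [split=> //; exists (B 0%N)|exists i].
have xB : sup (range A) <= B i by exact: ge_sup.
have [q' AE] : exists q' : nat, A i = (q'%:R + 1 / 4) * pi / (s i)%:R.
  by case: i {xA xB} => [|i]; [exists 0%N; rewrite /= add0r|exists (q (A i) (s i.+1))].
apply: (sin_sqr_ge q'); move: xA xB; rewrite /B AE.
move: (sR i); set v := (s i)%:R => v0.
rewrite ler_pdivrMr// [(_ * _ / _) + _](_ : _ = ((q'%:R + 3 / 4) * pi) / v); last first.
  by field; rewrite gt_eqF.
rewrite ler_pdivlMr// => h1 h2; apply/andP; split; lra.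
Qed.

(** Otherwise [|b l| >= e] along indices growing at least fourfold. At the point given by
    [lacunary_sin_large] the sines there are at least [1/sqrt 2] in absolute value, so the terms
    exceed [e / 2]. *)
Lemma Cantor_Lebesgue_sin {R : realType} (b : nat -> R) :
  (forall x : R, (fun l => b l * sin (l%:R * x)) @ \oo --> (0 : R)) ->
  b @ \oo --> (0 : R).
Proof.
move=> bsin; apply/cvgr0Pnorm_lt => e e0; apply: contrapT => nb.
have /choice[g gP] : forall N : nat, exists l, (N <= l)%N /\ e <= `|b l|.
  move=> N; apply: contrapT => h; apply: nb; exists N => // l /= Nl.
  by rewrite ltNge; apply/negP => el; apply: h; exists l.
pose s := fix s i := match i with 0%N => g 1%N | i.+1 => g (4 * s i)%N end.
have s0 : (0 < s 0)%N by have [] := gP 1%N.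
have s4 i : (4 * s i <= s i.+1)%N by have [] := gP (4 * s i)%N.
have si i : (i < s i)%N by elim: i => // i; have := s4 i; lia.
have bs i : e <= `|b (s i)| by case: i => [|i]; [have [] := gP 1%N|have [] := gP (4 * s i)%N].
have [x xP] := @lacunary_sin_large R s s0 s4.
have /cvgr0Pnorm_lt/(_ (e / 2)) := bsin x.
move=> /(_ (divr_gt0 e0 (ltr0Sn _ _)))[N _] /(_ (s N) (ltnW (si N))).
rewrite /= normrM => h.
have := xP N; rewrite -real_normK ?num_real//; have := bs N.
move: h; set u := `|b _|; set v := `|sin _| => h h1 h2.
have v0 : 0 <= v := normr_ge0 _.
by nra.
Qed.

Section Coefficients.
Context {R : realType}.
Variables (a b : nat -> R) (f : R -> R).
Hypothesis hf : forall x : R, trig_partial_sum a b x @ \oo --> f x.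

Lemma cvg_trig_term0 (x : R) :
  (fun l => a l * cos (l%:R * x) + b l * sin (l%:R * x)) @ \oo --> (0 : R).
Proof.
rewrite -cvg_shiftS; apply: cvg_trans (cvgn_diff0 _ _ _ _ (hf x)).
apply: near_eq_cvg; near=> N.
by rewrite /trig_partial_sum [in X in X - _]big_nat_recr//= addrA [LHS]addrC addKr.
Unshelve. all: by end_near. Qed.

Lemma cvg_cos_coef0 : a @ \oo --> (0 : R).
Proof.
apply: cvg_trans (cvg_trig_term0 0); apply: near_eq_cvg; near=> l.
by rewrite mulr0 cos0 sin0 mulr0 mulr1 addr0.
Unshelve. all: by end_near. Qed.

(** The cosine part is bounded by [|a l|], already known to tend to 0 from the case [x = 0];
    subtracting it leaves the sine part. *)
Lemma cvg_sin_coef : b @ \oo --> (0 : R).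
Proof.
refine (Cantor_Lebesgue_sin b _) => x.
have acos : (fun l => a l * cos (l%:R * x)) @ \oo --> (0 : R).
  apply/norm_cvg0P; apply: (squeeze_cvgr (f := fun=> 0) (h := fun l => `|a l|)).
  - near=> l; rewrite normr_ge0 normrM ler_piMr//.
    by rewrite ler_norml cos_geN1 cos_le1.
  - exact: cvg_cst.
  - by apply/norm_cvg0P; exact: cvg_cos_coef0.
rewrite -[0 in X in _ --> X](subrr (0 : R)).
apply: cvg_trans (cvgB (cvg_trig_term0 x) acos); apply: near_eq_cvg; near=> l => /=.
by rewrite addrAC subrr add0r.
Unshelve. all: by end_near. Qed.

Lemma ccoef_norm_le (p : int) : p != 0 ->
  `|ccoef a b p| <= (`|a `|p|%N| + `|b `|p|%N|)%:C.
Proof.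
have sqrt_le (x y : R) : Num.sqrt ((x / 2) ^+ 2 + (y / 2) ^+ 2) <= `|x| + `|y|.
  rewrite -[leRHS]ger0_norm ?addr_ge0// -sqrtr_sqr ler_sqrt ?sqr_ge0//.
  rewrite !expr_div_n -(real_normK (num_real x)) -(real_normK (num_real y)).
  by have := normr_ge0 x; have := normr_ge0 y; nra.
by case: p => [[|l]|l] // _; rewrite normc_def lecR /= ?sqrrN; exact: sqrt_le.
Qed.

(* [g l] stands for [l] or [- l]. *)
Lemma cvg_ccoef0 (g : nat -> int) : (forall l, `|g l|%N = l) ->
  (fun l => ccoef a b (g l) : (R[i])^o) @ \oo --> (0 : (R[i])^o).
Proof.
(* A positive element of [R[i]] has zero imaginary part, so the tolerance is the real number
   [e1]. *)
move=> gl; apply/cvgr0Pnorm_lt => -[e1 e2]; rewrite ltcE /= => /andP[/eqP -> e0].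
have e20 : 0 < e1 / 2 by rewrite divr_gt0.
have /cvgr0Pnorm_lt/(_ _ e20) an := cvg_cos_coef0.
have /cvgr0Pnorm_lt/(_ _ e20) bn := cvg_sin_coef.
near=> l; have l0 : (0 < l)%N by near: l; exists 1%N.
apply: le_lt_trans (ccoef_norm_le _ _) _; first by rewrite -absz_gt0 gl.
by rewrite gl ltcR [ltRHS]splitr ltrD//; near: l.
Unshelve. all: by end_near. Qed.

End Coefficients.

(** * Symmetric partial sums and their shifts *)

Lemma cvg_realC {R : realType} (u : nat -> R) (l : R) :
  u @ \oo --> l -> (fun N => (u N)%:C : (R[i])^o) @ \oo --> (l%:C : (R[i])^o).
Proof.
move=> /cvgrPdist_lt ul; apply/cvgrPdist_lt => -[e1 e2].
rewrite ltcE /= => /andP[/eqP -> /ul]; apply: filterS => N.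
by rewrite -rmorphB normc_def /= expr0n addr0 sqrtr_sqr ltcR.
Qed.

Definition symsum {V : zmodType} (G : int -> V) (N : nat) : V :=
  G 0 + \sum_(1 <= p < N.+1) (G p%:Z + G (- p%:Z)).

Lemma symsumS {V : zmodType} (G : int -> V) (N : nat) :
  symsum G N.+1 = symsum G N + (G N.+1%:Z + G (- N.+1%:Z)).
Proof. by rewrite /symsum big_nat_recr//= addrA. Qed.

Lemma symsumE {V : zmodType} (G : int -> V) (N : nat) :
  symsum G N = \sum_(i < (2 * N).+1) G (i%:Z - N%:Z).
Proof.
elim: N => [|N IH]; first by rewrite /symsum big_ord1 big_geq ?addr0.
rewrite symsumS IH mulnS 2!addSn add0n [RHS]big_ord_recl [X in _ = _ + X]big_ord_recr /=.
rewrite [RHS]addrC -addrA; congr (_ + _).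
  by apply: eq_bigr => i _; congr G; rewrite /bump /=; lia.
by congr (G _ + G _); rewrite /bump /=; lia.
Qed.

(** The shifted sum runs over indices from [-N-1] to [N-1]: it gains the term at [-N-1] and loses
    the one at [N]. *)
Lemma symsum_pred {V : zmodType} (G : int -> V) (N : nat) :
  symsum (fun l => G (l - 1)) N = symsum G N + (G (- N.+1%:Z) - G N%:Z).
Proof.
elim: N => [|N IH].
  by rewrite /symsum !big_geq// !addr0 sub0r addrCA subrr addr0.
rewrite !symsumS IH (_ : N.+1%:Z - 1 = N%:Z); last lia.
rewrite (_ : - N.+1%:Z - 1 = - N.+2%:Z); last lia.
rewrite -!addrA; congr (_ + _).
rewrite addKr; congr (_ + _).
by rewrite [RHS]addrC -!addrA addNr addr0.
Qed.

Section SymmetricSums.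
Context {K : numFieldType} {V : normedModType K}.
Implicit Types (G : int -> V) (l : V).

Definition vanishing G :=
  (fun N : nat => G N%:Z) @ \oo --> (0 : V) /\
  (fun N : nat => G (- N%:Z)) @ \oo --> (0 : V).

Lemma symsum_cvg_pred G l : vanishing G ->
  symsum G @ \oo --> l <-> symsum (fun p => G (p - 1)) @ \oo --> l.
Proof.
move=> [Gp Gn]; have dG : (fun N : nat => G (- N.+1%:Z) - G N%:Z) @ \oo --> (0 : V).
  rewrite -[0 in X in _ --> X](subrr (0 : V)); apply: cvgB Gp.
  by rewrite (cvg_shiftS (fun N : nat => G (- N%:Z))).
split=> [Gl|Gl].
  rewrite -[l]addr0; apply: cvg_trans (cvgD Gl dG); apply: near_eq_cvg; near=> N.
  exact/esym/(symsum_pred G).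
rewrite -[l]subr0; apply: cvg_trans (cvgB Gl dG); apply: near_eq_cvg; near=> N.
exact: canLR (addrK _) (symsum_pred G N).
Unshelve. all: by end_near. Qed.

Lemma vanishing_pred G : vanishing G -> vanishing (fun p => G (p - 1)).
Proof.
move=> [Gp Gn]; split.
  rewrite -cvg_shiftS; apply: cvg_trans Gp; apply: near_eq_cvg; near=> N.
  by congr G; lia.
rewrite -(cvg_shiftS (fun N : nat => G (- N%:Z))) in Gn.
apply: cvg_trans Gn; apply: near_eq_cvg; near=> N.
by congr G; lia.
Unshelve. all: by end_near. Qed.

Lemma vanishing_succ G : vanishing G -> vanishing (fun p => G (p + 1)).
Proof.
move=> [Gp Gn]; split.
  rewrite -(cvg_shiftS (fun N : nat => G N%:Z)) in Gp.
  apply: cvg_trans Gp; apply: near_eq_cvg; near=> N.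
  by congr G; lia.
rewrite -cvg_shiftS; apply: cvg_trans Gn; apply: near_eq_cvg; near=> N.
by congr G; lia.
Unshelve. all: by end_near. Qed.

Lemma symsum_cvg_shift G l (q : int) : vanishing G ->
  symsum G @ \oo --> l -> symsum (fun p => G (p - q)) @ \oo --> l.
Proof.
move=> G0 Gl; suff [] : vanishing (fun p => G (p - q)) /\
  symsum (fun p => G (p - q)) @ \oo --> l by [].
elim: q => [|q [q0 ql]|q [q0 ql]].
- by rewrite (_ : (fun _ => _) = G)//; apply/funext => p; rewrite subr0.
- rewrite (_ : (fun _ => _) = fun p => (fun p => G (p - q%:Z)) (p - 1)); last first.
    by apply/funext => p; congr G; lia.
  by split; [exact: (vanishing_pred _ q0)|exact: (symsum_cvg_pred _ _ q0).1 ql].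
- set F := (F in vanishing F); have F0 : vanishing F.
    rewrite (_ : F = fun p => (fun p => G (p - (- q%:Z))) (p + 1)).
      exact: (vanishing_succ _ q0).
    by apply/funext => p; congr G; lia.
  (* Delaying [F] by one index gives the family of the induction hypothesis, so the equivalence is
     used from right to left. *)
  split=> //; refine ((symsum_cvg_pred _ _ F0).2 _).
  rewrite (_ : (fun _ => _) = fun p => G (p - (- q%:Z)))//.
  by apply/funext => p; rewrite /F; congr G; lia.
Qed.

End SymmetricSums.

(** * Convergence of the product series *)

Section FourierSeries.
Context {R : realType}.
Variables (a b : nat -> R) (f : R -> R).
Hypothesis hf : forall x : R, trig_partial_sum a b x @ \oo --> f x.

Definition fourier_term (x : R) (p : int) : (R[i])^o :=
  ccoef a b p * expi (p%:~R * x).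

Lemma vanishing_fourier_term x : vanishing (fourier_term x).
Proof.
have term0 (g : nat -> int) : (forall l, `|g l|%N = l) ->
    (fun l => fourier_term x (g l)) @ \oo --> (0 : (R[i])^o).
  move=> gl; apply/norm_cvg0P.
  apply: cvg_trans ((norm_cvg0P _).2 (cvg_ccoef0 _ _ _ hf _ gl)).
  apply: near_eq_cvg; near=> l.
  by rewrite /fourier_term normrM norm_expi mulr1.
by split; apply: term0 => l; lia.
Unshelve. all: by end_near. Qed.

(** The terms of index [l] and [-l] are conjugate, so each pair adds up to the real term of index
    [l]. *)
Lemma symsum_fourier_term x N :
  symsum (fourier_term x) N = (trig_partial_sum a b x N)%:C.
Proof.
rewrite /symsum /trig_partial_sum rmorphD rmorph_sum; congr (_ + _).
  by rewrite /fourier_term mul0r expi0 mulr1.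
rewrite big_nat [RHS]big_nat; apply: eq_bigr => -[|l]//= _.
rewrite /fourier_term rmorphN mulNr /expi cosN sinN /=.
apply/eqP; rewrite eq_complex /=.
by apply/andP; split; apply/eqP; field.
Qed.

Lemma cvg_symsum_fourier x :
  symsum (fourier_term x) @ \oo --> ((f x)%:C : (R[i])^o).
Proof.
rewrite (_ : symsum _ = fun N => (trig_partial_sum a b x N)%:C).
  exact: cvg_realC.
by apply/funext => N; exact: symsum_fourier_term.
Qed.

(** Exchanging the finite sums, each exponential of [u] shifts the series of [f] by its own
    frequency. *)
Lemma symsum_mul_coef M (u : int -> R[i]) x N :
  symsum (fun p => mul_coef M u (ccoef a b) p * expi (p%:~R * x)) N =
  \sum_(i < (2 * M).+1) u (i%:Z - M%:Z) * expi ((i%:Z - M%:Z)%:~R * x) *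
    symsum (fun p => fourier_term x (p - (i%:Z - M%:Z))) N.
Proof.
rewrite symsumE; under eq_bigr do rewrite mulr_suml.
rewrite exchange_big /=; apply: eq_bigr => i _.
rewrite symsumE mulr_sumr; apply: eq_bigr => p _.
set q := i%:Z - M%:Z; set r := p%:Z - N%:Z.
rewrite /fourier_term (_ : r%:~R * x = q%:~R * x + (r - q)%:~R * x); last first.
  by rewrite -mulrDl -rmorphD addrC subrK.
by rewrite expiD; ring.
Qed.

Lemma cvg_symsum_mul_coef M (u : int -> R[i]) x :
  symsum (fun p => mul_coef M u (ccoef a b) p * expi (p%:~R * x) : (R[i])^o)
    @ \oo --> (trig_poly M u x * (f x)%:C : (R[i])^o).
Proof.
rewrite /trig_poly mulr_suml; set S := symsum _.
rewrite (_ : S = fun N => \sum_(i < (2 * M).+1)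
    u (i%:Z - M%:Z) * expi ((i%:Z - M%:Z)%:~R * x) *
    symsum (fun p => fourier_term x (p - (i%:Z - M%:Z))) N); last first.
  by apply/funext => N; exact: symsum_mul_coef.
apply: cvg_big => [|i _]; first exact: add_continuous.
apply: cvgM; first exact: cvg_cst.
exact: symsum_cvg_shift (vanishing_fourier_term x) (cvg_symsum_fourier x).
Qed.
End FourierSeries.

(** * The remainder as the tail of the product series *)

Lemma symsum_trunc {V : zmodType} (G : int -> V) (K L N : nat) :
  (K <= L)%N -> (L <= N)%N ->
  (forall p : int, (K < `|p| <= L)%N -> G p = 0) ->
  symsum G N = symsum G K + \sum_(L.+1 <= p < N.+1) (G p%:Z + G (- p%:Z)).
Proof.
move=> KL LN G0; rewrite /symsum (@big_cat_nat _ _ _ K.+1)//= -?addrA; last lia.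
congr (_ + (_ + _)); rewrite (@big_cat_nat _ _ _ L.+1)//=.
rewrite big_nat big1 ?add0r// => p hp.
by rewrite !G0 ?addr0//; lia.
Qed.

Theorem theorem3 (R : realType) (k : nat) (hk : (1 <= k)%N)
    (a b : 'I_k -> nat -> R) (f : 'I_k -> R -> R)
    (hf : forall (j : 'I_k) (x : R),
       trig_partial_sum (a j) (b j) x @ \oo --> f j x)
    (n : nat) (m : 'I_k -> nat) (hm : exists j : 'I_k, m j <> 0%N) :
  let c := fun j : 'I_k => ccoef (a j) (b j) in
  (has_unique_solution c n m <-> weakly_normal c n m) /\
  (weakly_normal c n m ->
     is_solution c n m (Ddet c n m) (Psol c n m) /\
     forall j : 'I_k,
       is_remainder_series c n m j (Ddet c n m) (Psol c n m j)
         (fun l : int => if (n + mtotal m < `|l|)%N then ddet c n m j l else 0) /\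
       forall x : R,
         (remainder_partial_sum c n m j x : nat -> (R[i])^o) @ \oo -->
           (Ddet c n m x * (f j x)%:C - Psol c n m j x : (R[i])^o)).
Proof.
move=> c; split; first exact: has_unique_solutionP.
move=> wn; pose w := mid_cofactors c n m.
have wker : (w <= kermx (Hmx c n m)^T)%MS := mid_cofactors_ker c n m.
have QE : Ddet c n m = Qker m w by apply/funext => x; exact: DdetE.
have PE : Psol c n m = Pker c n m w.
  by apply/funext => j; apply/funext => x; exact: PsolE.
have dE j : ddet c n m j = mul_row c m w j by apply/funext => l; exact: ddetE.
split; first by rewrite QE PE; apply: is_solution_ker => //; exact: mid_cofactors_neq0.
move=> j; split; first by rewrite QE PE dE; exact: is_remainder_ker.
move=> x; pose G (p : int) : (R[i])^o := mul_row c m w j p * expi (p%:~R * x).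
have GS : symsum G @ \oo --> (Ddet c n m x * (f j x)%:C : (R[i])^o).
  rewrite QE (_ : symsum G = symsum (fun p =>
    mul_coef (mtotal m) (row_coef (mtotal m) w) (c j) p * expi (p%:~R * x))).
    exact: cvg_symsum_mul_coef (hf j) _ _ _.
  by congr symsum; apply/funext => p; rewrite /G mul_rowE.
apply: cvg_trans (cvgB GS (cvg_cst (Psol c n m j x : (R[i])^o))).
apply: near_eq_cvg; near=> N => /=.
have nN : (n + mtotal m <= N)%N by near: N; exists (n + mtotal m)%N.
(* The kernel condition empties the band between [n_j] and [n + m]: the inner block of the symmetric
   sum is [P_j], and the rest is the remainder sum. *)
have G0 (p : int) : (ndeg n m j < `|p| <= n + mtotal m)%N -> G p = 0.
  by move=> hp; rewrite /G ((kerHP c n m w).1 wker)// mul0r.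
have le_ndeg : (ndeg n m j <= n + mtotal m)%N by rewrite leq_subr.
rewrite -[LHS]/(symsum G N - Psol c n m j x) (symsum_trunc _ _ _ _ le_ndeg nN G0).
rewrite PE symsumE addrAC subrr add0r; apply: eq_bigr => p _.
by rewrite /G dE rmorphN mulNr.
Unshelve. all: by end_near. Qed.
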